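(* For every integer $n\ge 0$, $$\sum_{l=0}^{n}\binom{n}{l}q^{l}\,\mathcal{E}_{l,q}+\mathcal{E}_{n,q}=\begin{cases}[2]_q, & \text{if } n=0,\\ 0, & \text{if } n\neq 0.\end{cases}$$ (Symbolically, $(q\mathcal{E}+1)^n+\mathcal{E}_{n,q}$ equals $[2]_q$ if $n=0$ and $0$ if $n\ne 0$, where after expanding the binomial $\mathcal{E}^i$ is replaced by $\mathcal{E}_{i,q}$.)
   Context: Let $p$ be a fixed odd prime, $\mathbb{Z}_p$ the ring of $p$-adic integers, $\mathbb{C}_p$ the completion of an algebraic closure of $\mathbb{Q}_p$, with absolute value normalized by $|p|_p=1/p$. Let $q\in\mathbb{C}_p$ with $|q-1|_p<p^{-1/(p-1)}$ and $q\neq 1$, and put $q^x=\exp(x\log q)$ for $x\in\mathbb{Z}_p$. Write $[x]_q=\frac{1-q^x}{1-q}$ and, for $N\in\mathbb{N}$, $[N]_{-q}=\frac{1-(-q)^N}{1+q}$; in particular $[2]_q=1+q$. The convention $[0]_q^0=1$ is used. The fermionic $p$-adic $q$-integral of a function $f$ on $\mathbb{Z}_p$ is $$I_{-q}(f)=\int_{\mathbb{Z}_p}f(x)\,d\mu_{-q}(x)=\lim_{N\to\infty}\frac{1}{[p^N]_{-q}}\sum_{x=0}^{p^N-1}f(x)(-q)^x .$$ The modified $q$-Euler numbers are, for $n\ge 0$, $$\mathcal{E}_{n,q}=\int_{\mathbb{Z}_p}q^{-x}[x]_q^n\,d\mu_{-q}(x)=[2]_q\Big(\frac{1}{1-q}\Big)^n\sum_{l=0}^n\binom{n}{l}(-1)^l\frac{1}{1+q^l}.$$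 *)

(* Defs.v *)
From HB Require Import structures.
From mathcomp Require Import all_boot all_order all_algebra.
From mathcomp Require Import all_classical all_reals all_analysis.

Set Implicit Arguments.
Unset Strict Implicit.
Unset Printing Implicit Defensive.
Import Order.TTheory GRing.Theory Num.Theory.
Local Open Scope classical_set_scope.
Local Open Scope ring_scope.

(* No concrete p-adic fields are available, so C_p is described by its
   definition: a field K, complete for an ultrametric absolute value with
   |p| = 1/p, in which an algebraic closure of Q_p is dense.  This determines
   K up to isometric isomorphism.  The norms of NormedZmodule and of normed
   modules do not apply, since they require |x *+ n| = |x| *+ n. *)

HB.mixin Record UniformField_isPadicValued (p : nat) (R : realType) K
    & GRing.Field K & Uniform K := {
  vabs : K -> R;
  vabs_ge0 : forall x, 0 <= vabs x;
  vabs_eq0 : forall x, vabs x = 0 -> x = 0;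
  vabsM : forall x y, vabs (x * y) = vabs x * vabs y;
  vabsD : forall x y, vabs (x + y) <= Num.max (vabs x) (vabs y);
  vabs_p : vabs p%:R = p%:R^-1;
  (* the uniform structure, hence the topology, is the one defined by vabs *)
  entourage_vabs : @entourage K =
    filter_from [set e : R | 0 < e]
      (fun e => [set xy : K * K | vabs (xy.1 - xy.2) < e]);
  (* library completeness (Complete) also asks for a distinguished point *)
  vabs_complete : forall F : set_system K,
    ProperFilter F -> cauchy F -> exists l : K, F --> l
}.

#[short(type="padicValuedFieldType")]
HB.structure Definition PadicValuedField (p : nat) (R : realType) :=
  {K of GRing.Field K & Uniform K & UniformField_isPadicValued p R K}.

Section PadicSubsets.
Context {p : nat} {R : realType}.
Variable K : padicValuedFieldType p R.

(* As K is complete, the closures of Z and Q in K are their p-adic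
   completions Z_p and Q_p. *)
Definition padic_int : set K := closure (range (fun m : int => m%:~R)).
Definition padic_num : set K := closure (range (fun r : rat => ratr r)).

(* the elements of K that are algebraic over Q_p *)
Definition padic_alg : set K :=
  [set x | exists P : {poly K},
     [/\ P != 0, forall i, padic_num (P`_i) & root P x]].

Lemma nat_padic_int (n : nat) : (n%:R : K) \in padic_int.
Proof. by rewrite inE; apply: subset_closure; exists n%:Z. Qed.

Definition nat_Zp (n : nat) : set_type padic_int := SigSub (nat_padic_int n).

End PadicSubsets.

Arguments padic_int {p R} K _.
Arguments padic_num {p R} K _.
Arguments padic_alg {p R} K _.
Arguments nat_Zp {p R} K n.

HB.mixin Record PadicValuedField_isComplexPadic (p : nat) (R : realType) K
    & PadicValuedField p R K := {
  padic_alg_closed : forall P : {poly K},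
    (forall i, padic_alg K P`_i) -> (1 < size P)%N ->
    exists2 x : K, padic_alg K x & root P x;
  padic_alg_dense : dense (padic_alg K)
}.

#[short(type="complexPadicType")]
HB.structure Definition ComplexPadic (p : nat) (R : realType) :=
  {K of PadicValuedField p R K & PadicValuedField_isComplexPadic p R K}.

Section QEuler.
Context {p : nat} {R : realType} {K : complexPadicType p R}.
Implicit Types q x : K.

(* limn of the library, with 0 as the distinguished point of K *)
Definition limK (u : nat -> K) : K := xget 0 [set l : K | u @ \oo --> l].

Definition padic_exp x : K := limK (series (fun k => x ^+ k / k`!%:R)).

(* log q = \sum_(k >= 1) (-1)^(k-1) (q - 1)^k / k *)
Definition padic_log q : K :=
  limK (series (fun k => (-1) ^+ k * (q - 1) ^+ k.+1 / k.+1%:R)).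

Definition qpow q x : K := padic_exp (x * padic_log q).

Definition qbracket q x : K := (1 - qpow q x) / (1 - q).

Definition mqbracket q (N : nat) : K := (1 - (- q) ^+ N) / (1 + q).

(* The weight (-q)^x, x a natural number, is an ordinary power: qpow does not
   apply since -q is not close to 1. *)
Definition fermionic_integral q (f : set_type (padic_int K) -> K) : K :=
  limK (fun N : nat => (mqbracket q (p ^ N))^-1 *
    \sum_(0 <= x < p ^ N) f (nat_Zp K x) * (- q) ^+ x).

Definition qEuler (n : nat) q : K :=
  fermionic_integral q
    (fun z => qpow q (- val z) * qbracket q (val z) ^+ n).

End QEuler.

(* Main.v *)
Require Import Defs.
From mathcomp Require Import all_boot all_order all_algebra.
From mathcomp Require Import all_classical all_reals all_analysis.
From mathcomp Require Import ring zify.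
Set Implicit Arguments.
Unset Strict Implicit.
Unset Printing Implicit Defensive.
Import Order.TTheory GRing.Theory Num.Theory.
Import numFieldNormedType.Exports.
Local Open Scope ring_scope.

(** Write [[x]] for [(1 - q ^ x) / (1 - q)].  On natural numbers the integrand
    [q ^ (- x) * [x] ^ n] times the weight [(- q) ^ x] is [(- 1) ^ x * [x] ^ n],
    so [qEuler n q] is the limit of a normalizing factor times the alternating
    moment [S n N = \sum_(x < p ^ N) (- 1) ^ x * [x] ^ n].  Because
    [[x + 1] = 1 + q * [x]], the binomial formula gives
    [\sum_(l <= n) 'C(n, l) * q ^ l * S l N + S n N =
     \sum_(x < p ^ N) (- 1) ^ x * ([x + 1] ^ n + [x] ^ n)],
    which telescopes, [p ^ N] being odd, to [[0] ^ n + [p ^ N] ^ n]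
    ([alternating_moment_rec]).  Since [q ^ (p ^ N)] tends to 1, [[p ^ N]]
    tends to 0 and the right-hand side to [2 * 0 ^ n]; the normalizing factor
    tends to [(1 + q) / 2].  The theorem is the product of these limits.  The
    same identity shows that the moments converge: the coefficient of [S n] is
    [1 + q ^ n], of absolute value 1 because [p] is odd and [q] is close to 1,
    so [S n] is determined by the [S l] with [l < n]
    ([alternating_moment_cvg]).

    All this supposes that [q ^ x], which is defined as [exp (x * log q)], is
    the ordinary power for integers [x].  As [exp] is additive on its disc of
    convergence (Cauchy product, [padic_expD]), it is enough that
    [exp (log q) = q] ([padic_exp_log]).  This is proved without composing
    power series.  Let [u = exp (log q) / q] and [M = p ^ N].  Both
    [exp (log q) ^ M = exp (M * log q)] and [q ^ M] equal [1 + M * log q] up to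
    an error of order [M ^ 2] ([vabs_padic_exp_linear], [vabs_exprn_log]), so
    [u ^ M - 1] is of order [M ^ 2].  But raising to the [p]-th power multiplies
    the distance to 1 by exactly [|p|] on that disc ([vabs_exprp_sub1]), so
    [|u ^ M - 1| = |M| * |u - 1|].  Hence [|u - 1|] is of order [M] for all [N],
    and [u = 1]. *)

(** * The absolute value *)

Section AbsoluteValue.
Context {p : nat} (p_prime : prime p) {R : realType}.
Context {K : padicValuedFieldType p R}.
Implicit Types x y : K.

Let p_gt0 : 0 < p%:R :> R. Proof. by rewrite ltr0n prime_gt0. Qed.
Let p_gt1 : 1 < p%:R :> R. Proof. by rewrite ltr1n prime_gt1. Qed.

(** [|0| = |0| * |p|], and [|p|] is not 1. *)
Lemma vabs0 : vabs (0 : K) = 0.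
Proof.
have := vabsM (0 : K) p%:R; rewrite mul0r vabs_p => h0.
have /eqP : vabs (0 : K) * (1 - p%:R^-1) = 0 by rewrite mulrBr mulr1 -h0 subrr.
rewrite mulf_eq0 subr_eq0 => /orP[/eqP //|/eqP h1].
by move: p_gt1; rewrite -[p%:R]invrK -h1 invr1 ltxx.
Qed.

Lemma vabs_eq0P x : (vabs x == 0) = (x == 0).
Proof. by apply/eqP/eqP => [/vabs_eq0 //|->]; exact: vabs0. Qed.

Lemma vabs_gt0 x : (0 < vabs x) = (x != 0).
Proof. by rewrite lt_def vabs_ge0 andbT vabs_eq0P. Qed.

Lemma vabs1 : vabs (1 : K) = 1.
Proof.
have h : vabs (1 : K) != 0 by rewrite vabs_eq0P oner_eq0.
by apply: (mulfI h); rewrite -vabsM !mulr1.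
Qed.

Lemma vabsN x : vabs (- x) = vabs x.
Proof.
apply/eqP; rewrite -(@eqrXn2 _ 2) ?vabs_ge0 //.
by rewrite !expr2 -!vabsM mulrNN.
Qed.

Lemma vabsBC x y : vabs (x - y) = vabs (y - x).
Proof. by rewrite -vabsN opprB. Qed.

Lemma vabsX x n : vabs (x ^+ n) = vabs x ^+ n.
Proof. by elim: n => [|n IHn]; rewrite ?expr0 ?vabs1 // !exprS vabsM IHn. Qed.

Lemma vabsV x : vabs x^-1 = (vabs x)^-1.
Proof.
have [->|x0] := eqVneq x 0; first by rewrite !(invr0, vabs0).
have h : vabs x != 0 by rewrite vabs_eq0P.
by apply: (mulfI h); rewrite -vabsM !divff // vabs1.
Qed.

Lemma vabsD_le x y (B : R) : vabs x <= B -> vabs y <= B -> vabs (x + y) <= B.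
Proof.
by move=> hx hy; apply: (le_trans (vabsD _ _)); rewrite ge_max hx hy.
Qed.

Lemma vabsD_add x y : vabs (x + y) <= vabs x + vabs y.
Proof.
by apply: le_trans (vabsD _ _) _; rewrite ge_max lerDl lerDr !vabs_ge0.
Qed.

Lemma vabsD_lt x y (B : R) : vabs x < B -> vabs y < B -> vabs (x + y) < B.
Proof.
by move=> hx hy; apply: (le_lt_trans (vabsD _ _)); rewrite gt_max hx hy.
Qed.

Lemma vabsB_le x y (B : R) : vabs x <= B -> vabs y <= B -> vabs (x - y) <= B.
Proof. by move=> hx hy; apply: vabsD_le; rewrite ?vabsN. Qed.

(** If [|x + y|] were smaller than [|x|], then so would be [|x|] itself, as [x]
    is the difference of [x + y] and [y]. *)
Lemma vabsD_dominant x y : vabs y < vabs x -> vabs (x + y) = vabs x.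
Proof.
move=> yx; apply/le_anti/andP; split; first exact: vabsD_le (lexx _) (ltW yx).
rewrite leNgt; apply/negP => h.
by have := vabsD_lt h (_ : vabs (- y) < _); rewrite vabsN addrK ltxx => /(_ yx).
Qed.

Lemma vabs_near1 x : vabs (x - 1) < 1 -> vabs x = 1.
Proof.
by move=> x1; rewrite -(subrK 1 x) addrC vabsD_dominant vabs1.
Qed.

Lemma vabs_sum_le (I : Type) (r : seq I) (P : pred I) (F : I -> K) (B : R) :
  0 <= B -> (forall i, P i -> vabs (F i) <= B) ->
  vabs (\sum_(i <- r | P i) F i) <= B.
Proof.
move=> B0 FB; apply: (big_ind (fun x => vabs x <= B)) => //.
  by rewrite vabs0.
by move=> x y; exact: vabsD_le.
Qed.

Lemma vabs_sum_lt (I : Type) (r : seq I) (P : pred I) (F : I -> K) (B : R) :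
  0 < B -> (forall i, P i -> vabs (F i) < B) ->
  vabs (\sum_(i <- r | P i) F i) < B.
Proof.
move=> B0 FB; apply: (big_ind (fun x => vabs x < B)) => //.
  by rewrite vabs0.
by move=> x y; exact: vabsD_lt.
Qed.

Lemma vabs_nat_le1 n : vabs (n%:R : K) <= 1.
Proof.
elim: n => [|n IHn]; first by rewrite vabs0 ler01.
by rewrite -addn1 natrD; apply: vabsD_le; rewrite ?vabs1.
Qed.

(** A Bezout relation [u * n = v * p + 1] writes 1 as a combination of [n] and
    [p], and the absolute value of [p] is too small to account for 1. *)
Lemma vabs_nat_coprime n : coprime p n -> vabs (n%:R : K) = 1.
Proof.
move=> cop; apply/le_anti; rewrite vabs_nat_le1 /= leNgt; apply/negP => n_lt1.
have n_gt0 : (0 < n)%N.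
  by case: n cop {n_lt1} => //; rewrite /coprime gcdn0 gtn_eqF ?prime_gt1.
case: (egcdnP p n_gt0) => u v; rewrite gcdnC (eqP cop) => uv _.
have : (u%:R * n%:R - v%:R * p%:R : K) = 1.
  by rewrite -!natrM uv natrD addrC addKr.
move=> /(congr1 vabs); rewrite vabs1 => h1.
suff : 1 < 1 :> R by rewrite ltxx.
rewrite -{1}h1; apply: vabsD_lt; rewrite ?vabsN vabsM.
  by apply: le_lt_trans n_lt1; rewrite ler_piMl ?vabs_ge0 ?vabs_nat_le1.
rewrite vabs_p; apply: le_lt_trans (_ : p%:R^-1 < 1); last by rewrite invf_lt1.
by rewrite ler_piMl ?vabs_nat_le1 // invr_ge0 ltW.
Qed.

Lemma vabs_nat n : (0 < n)%N -> vabs (n%:R : K) = p%:R^-1 ^+ logn p n.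
Proof.
move=> n_gt0; have [m cop n_eq] := pfactor_coprime p_prime n_gt0.
by rewrite {1}n_eq natrM natrX vabsM vabsX vabs_p (vabs_nat_coprime cop) mul1r.
Qed.

(** Characteristic 0 is a consequence of [|p| = 1 / p]: the absolute value of a
    positive integer is a power of [1 / p]. *)
Lemma natf_eq0_padic n : ((n%:R : K) == 0) = (n == 0)%N.
Proof.
case: n => [|n]; first by rewrite mulr0n !eqxx.
by rewrite -vabs_eq0P vabs_nat // expf_eq0 invr_eq0 (gt_eqF p_gt0) andbF.
Qed.

(** The power of [p] that divides [n] is at most [n]. *)
Lemma vabs_natV_le n : (0 < n)%N -> vabs (n%:R^-1 : K) <= n%:R.
Proof.
move=> n_gt0; rewrite vabsV vabs_nat // exprVn invrK -natrX ler_nat.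
by rewrite dvdn_leq // pfactor_dvdnn.
Qed.

End AbsoluteValue.

(** * Limits and series *)

Section Limits.
Local Open Scope classical_set_scope.
Context {p : nat} (p_prime : prime p) {R : realType}.
Context {K : padicValuedFieldType p R}.
Implicit Types (x y l : K) (u v t : nat -> K).

(** The link between the topology of [K] and its absolute value; it reduces
    convergence in [K] to convergence of real sequences. *)
Lemma cvg_vabsP u l :
  u @ \oo --> l <-> vabs (u n - l) @[n --> \oo] --> (0 : R).
Proof.
rewrite cvg_app_entourageP entourage_vabs cvgrPdist_lt; split.
  move=> ul e e_gt0.
  have /ul : filter_from [set e : R | 0 < e]
      (fun e => [set xy : K * K | vabs (xy.1 - xy.2) < e])
      [set xy | vabs (xy.1 - xy.2) < e] by exists e.
  by apply: filterS => n /=; rewrite sub0r normrN ger0_norm ?vabs_ge0 // vabsBC.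
move=> ul A [e e_gt0 eA]; apply: filterS (ul e e_gt0) => n h; apply: eA => /=.
by move: h; rewrite sub0r normrN ger0_norm ?vabs_ge0 // vabsBC.
Qed.

Lemma vabs_cvg_squeeze u l (b : nat -> R) : (forall n, vabs (u n - l) <= b n) ->
  b @ \oo --> 0 -> u @ \oo --> l.
Proof.
move=> ub b0; apply/cvg_vabsP; apply: (squeeze_cvgr _ (cvg_cst 0) b0).
by apply: nearW => n; rewrite vabs_ge0 ub.
Qed.

Lemma padic_cvgD u v l l' :
  u @ \oo --> l -> v @ \oo --> l' -> (fun n => u n + v n) @ \oo --> l + l'.
Proof.
move=> /cvg_vabsP ul /cvg_vabsP vl.
apply: (@vabs_cvg_squeeze _ _ (fun n => vabs (u n - l) + vabs (v n - l'))).
  by move=> n; rewrite opprD addrACA vabsD_add.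
by rewrite -[X in _ --> X]addr0; apply: cvgD.
Qed.

Lemma padic_cvgMl u l x : u @ \oo --> l -> (fun n => x * u n) @ \oo --> x * l.
Proof.
move=> /cvg_vabsP ul.
apply: (@vabs_cvg_squeeze _ _ (fun n => vabs x * vabs (u n - l))).
  by move=> n; rewrite -mulrBr vabsM.
by rewrite -(mulr0 (vabs x)); apply: cvgM => //; exact: cvg_cst.
Qed.

Lemma padic_cvgM u v l l' :
  u @ \oo --> l -> v @ \oo --> l' -> (fun n => u n * v n) @ \oo --> l * l'.
Proof.
move=> /cvg_vabsP ul /cvg_vabsP vl.
apply: (@vabs_cvg_squeeze _ _ (fun n => vabs (u n - l) * vabs (v n - l') +
    vabs l * vabs (v n - l') + vabs (u n - l) * vabs l')).
  move=> n; rewrite (_ : _ - _ = (u n - l) * (v n - l') + l * (v n - l')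
    + (u n - l) * l'); last by ring.
  apply: le_trans (vabsD_add _ _) _; rewrite -!vabsM lerD2r.
  exact: vabsD_add.
have -> : 0 = 0 * 0 + vabs l * 0 + 0 * vabs l' :> R.
  by rewrite !(mulr0, mul0r) !addr0.
by apply: cvgD; [apply: cvgD|]; apply: cvgM => //; exact: cvg_cst.
Qed.

Lemma padic_cvg_sum (I : Type) (r : seq I) (f : I -> nat -> K) (g : I -> K) :
  (forall i, f i @ \oo --> g i) ->
  (fun n => \sum_(i <- r) f i n) @ \oo --> \sum_(i <- r) g i.
Proof.
move=> fg; elim: r => [|i r IHr].
  by rewrite big_nil; under eq_fun do rewrite big_nil; exact: cvg_cst.
by rewrite big_cons; under eq_fun do rewrite big_cons; exact: padic_cvgD.
Qed.

(** Near a nonzero limit [l] the ultrametric inequality forces [|u n| = |l|], so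
    [|l|] cannot exceed a bound that holds eventually for the [|u n|]. *)
Lemma vabs_lim_le u l (B : R) :
  u @ \oo --> l -> (\forall n \near \oo, vabs (u n) <= B) -> vabs l <= B.
Proof.
move=> /cvg_vabsP /cvgrPdist_lt ul uB; rewrite leNgt; apply/negP => Bl.
have l_gt0 : 0 < vabs l.
  have [n un] := @filter_ex _ _ _ _ uB.
  by apply: le_lt_trans Bl; exact: le_trans (vabs_ge0 _) un.
have [n [uln un]] := @filter_ex _ _ _ _ (filterI (ul _ l_gt0) uB).
move: uln => /=; rewrite sub0r normrN ger0_norm ?vabs_ge0 // => uln.
suff : vabs l < vabs l by rewrite ltxx.
rewrite -{1}(subrK (u n) l); apply: vabsD_lt; first by rewrite vabsBC.
exact: le_lt_trans Bl.
Qed.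

Lemma padic_cvg_unique u l l' : u @ \oo --> l -> u @ \oo --> l' -> l = l'.
Proof.
move=> ul ul'; apply/eqP; rewrite -subr_eq0 -(vabs_eq0P p_prime).
rewrite eq_le vabs_ge0 andbT.
have h : (fun n => u n + - 1 * u n) @ \oo --> l + -1 * l'.
  by apply: padic_cvgD => //; exact: padic_cvgMl.
rewrite mulN1r in h; apply: (vabs_lim_le h).
by apply: nearW => n; rewrite mulN1r subrr (vabs0 p_prime).
Qed.

(** For an ultrametric absolute value, the tails of a series are as small as
    their largest term, so that the partial sums form a Cauchy sequence as
    soon as the terms tend to 0. *)
Lemma padic_series_cvg t :
  t @ \oo --> (0 : K) -> exists l, series t @ \oo --> l.
Proof.
move=> /cvg_vabsP /cvgrPdist_lt t0; apply: vabs_complete.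
rewrite /cauchy entourage_vabs => A [e /= e_gt0 eA].
have [N _ tN] := t0 _ e_gt0.
have tail n : (N <= n)%N -> vabs (series t n - series t N) < e.
  move=> /subnKC <-; elim: (n - N)%N => [|k IHk].
    by rewrite addn0 subrr (vabs0 p_prime).
  rewrite addnS /series /= big_nat_recr //= addrAC; apply: vabsD_lt => //.
  have := tN (N + k)%N (leq_addr _ _).
  by rewrite /= sub0r normrN subr0 ger0_norm ?vabs_ge0.
exists (series t @` [set n | (N <= n)%N],
  series t @` [set n | (N <= n)%N]) => /=.
  by split; exists N => // n /= Nn; exists n.
move=> [_ _] /= [[m Nm <-] [n Nn <-]]; apply: eA => /=.
rewrite -(subrKA (series t N)); apply: vabsD_lt; first exact: tail.
by rewrite vabsBC; exact: tail.
Qed.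

End Limits.

Section LimitOperator.
Local Open Scope classical_set_scope.
Context {p : nat} (p_prime : prime p) {R : realType}.
Context {K : complexPadicType p R}.
Implicit Types (l : K) (u t : nat -> K).

Lemma limKE u l : u @ \oo --> l -> limK u = l.
Proof.
rewrite /limK => ul; case: xgetP => [l' _ ul'|/(_ l) //].
exact: (padic_cvg_unique p_prime ul' ul).
Qed.

Lemma series_limK t : t @ \oo --> (0 : K) -> series t @ \oo --> limK (series t).
Proof.
by move=> /(padic_series_cvg p_prime)[l tl]; rewrite (limKE tl).
Qed.

Lemma vabs_series_tail_le t m (B : R) : t @ \oo --> (0 : K) -> 0 <= B ->
  (forall k, (m <= k)%N -> vabs (t k) <= B) ->
  vabs (limK (series t) - series t m) <= B.
Proof.
move=> /series_limK tl B0 tB.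
have h : (fun n => series t n + - series t m) @ \oo -->
    limK (series t) - series t m.
  by apply: padic_cvgD => //; exact: cvg_cst.
apply: (vabs_lim_le h); exists m => // n /= mn.
rewrite /series /= (big_cat_nat (leq0n m) mn) /= addrAC subrr add0r.
rewrite big_nat; apply: vabs_sum_le => // k /andP[mk _]; exact: tB.
Qed.

End LimitOperator.

(** * The disc of convergence of the exponential *)

(** By Legendre's formula the valuation of [n`!] is the sum of the
    [n %/ p ^ k]. The inequality [p * (n %/ p ^ k.+1) <= n %/ p ^ k] bounds
    [p.-1] times a term by a difference of consecutive terms, so that the sum
    telescopes. *)
Lemma logn_fact_lt p n : prime p -> (0 < n)%N -> (p.-1 * logn p n`! < n)%N.
Proof.
move=> p_prime n_gt0; rewrite logn_fact //.
(* The term [maxn 1 _] keeps the last nonzero quotient, which is at least 1, in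
   the bound: this makes the inequality strict. *)
suff /(_ n) : forall m,
    (p.-1 * \sum_(1 <= k < m.+1) n %/ p ^ k + maxn 1 (n %/ p ^ m) <= n)%N.
  by lia.
elim=> [|m IHm]; first by rewrite big_geq // muln0 expn0 divn1; lia.
rewrite big_nat_recr //= expnSr divnMA mulnDr.
have := leq_trunc_div (n %/ p ^ m) p; move: IHm.
move: (p.-1 * \sum_(_ <= _ < _) _)%N (n %/ p ^ m)%N => S a.
move: (a %/ p)%N (prime_gt0 p_prime) => b; case: p {p_prime} => [//|p] _ /=.
by case: b => [|b]; lia.
Qed.

(** [k.+1 * c ^ k] is at most the geometric sum [1 + c + ... + c ^ k], since [c]
    is at most 1. *)
Lemma geometric_slope_bound (R : realDomainType) (c : R) k :
  0 <= c <= 1 -> k.+1%:R * c ^+ k * (1 - c) <= 1 - c ^+ k.+1.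
Proof.
move=> /andP[c0 c1]; elim: k => [|k IHk]; first by rewrite expr0 expr1 !mul1r.
have ck1 : c ^+ k.+1 <= 1 by rewrite exprn_ile1.
have -> : k.+2%:R * c ^+ k.+1 * (1 - c) =
    c * (k.+1%:R * c ^+ k * (1 - c)) + c ^+ k.+1 * (1 - c).
  by rewrite -[k.+2]addn1 natrD !exprS; ring.
apply: le_trans (lerD (ler_wpM2l c0 IHk) (lexx _)) _.
rewrite -subr_ge0 (_ : _ - _ = (1 - c) * (1 - c ^+ k.+1)); last first.
  by rewrite [c ^+ k.+2]exprS; ring.
by rewrite mulr_ge0 ?subr_ge0.
Qed.

(** The radius of convergence of the exponential series. *)
Definition exp_radius (p : nat) (R : realType) : R := p%:R `^ (- (p.-1%:R)^-1).

Section ExpRadius.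
Context {p : nat} (p_prime : prime p) {R : realType}.
Context {K : complexPadicType p R}.
Local Notation r := (exp_radius p R).

Lemma exp_radius_gt0 : 0 < r.
Proof. by rewrite powR_gt0 // ltr0n prime_gt0. Qed.

Lemma exp_radiusX : r ^+ p.-1 = p%:R^-1.
Proof.
have p1 : p.-1%:R != 0 :> R.
  by rewrite pnatr_eq0; have := prime_gt1 p_prime; lia.
rewrite -powR_mulrn ?ltW ?exp_radius_gt0 // /exp_radius -powRrM mulNr mulVf //.
by rewrite powR_inv1 // ler0n.
Qed.

Lemma exp_radius_lt1 : r < 1.
Proof.
rewrite ltNge; apply/negP => r1.
have := exprn_ege1 p.-1 r1; rewrite exp_radiusX invf_ge1 ?ltr0n ?prime_gt0 //.
by rewrite lern1 leqNgt prime_gt1.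
Qed.

Lemma vabs_fact_ge n : (0 < n)%N -> r ^+ n.-1 <= vabs (n`!%:R : K).
Proof.
move=> n_gt0; rewrite vabs_nat ?fact_gt0 // -exp_radiusX -exprM.
rewrite ler_wiXn2l ?ltW ?exp_radius_gt0 ?exp_radius_lt1 //.
by have := logn_fact_lt p_prime n_gt0; lia.
Qed.

(** The exponent [k.-1], rather than [k], leaves a factor [|x|] in front: the
    terms of the exponential series are then bounded by [|x|] itself, so that
    [exp] maps the disc into the disc of the same radius around 1. *)
Lemma vabs_exp_term (x : K) k : (0 < k)%N ->
  vabs (x ^+ k / k`!%:R) <= vabs x * (vabs x / r) ^+ k.-1.
Proof.
move=> k_gt0; rewrite vabsM vabsV // vabsX // -{1}(prednK k_gt0) exprS -mulrA.
rewrite ler_wpM2l ?vabs_ge0 // expr_div_n ler_wpM2l ?exprn_ge0 ?vabs_ge0 //.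
have rk : 0 < r ^+ k.-1 by rewrite exprn_gt0 ?exp_radius_gt0.
by rewrite lef_pV2 ?posrE ?vabs_fact_ge // (lt_le_trans rk) ?vabs_fact_ge.
Qed.

(** Terms of the logarithm are dominated by those of the exponential, because
    [k.+1] divides [k.+1`!]. *)
Lemma vabs_log_term (x : K) k :
  vabs (x ^+ k.+1 / k.+1%:R) <= vabs x * (vabs x / r) ^+ k.
Proof.
apply: le_trans (@vabs_exp_term x k.+1 isT).
rewrite !(vabsM, vabsV p_prime); apply: ler_wpM2l; first exact: vabs_ge0.
rewrite factS natrM vabsM invfM ler_peMr ?invr_ge0 ?vabs_ge0 //.
rewrite invf_ge1 ?vabs_nat_le1 // vabs_gt0 //.
by rewrite natf_eq0_padic // -lt0n fact_gt0.
Qed.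

Lemma ratio_itv (x : K) : vabs x < r -> 0 <= vabs x / r < 1.
Proof.
move=> xr; rewrite divr_ge0 ?vabs_ge0 ?ltW ?exp_radius_gt0 //=.
by rewrite ltr_pdivrMr ?exp_radius_gt0 // mul1r.
Qed.

Lemma radius_cvg (x : K) (t : nat -> K) : vabs x < r ->
  (forall k, (0 < k)%N -> vabs (t k) <= vabs x * (vabs x / r) ^+ k.-1) ->
  (t @ \oo --> (0 : K))%classic.
Proof.
move=> xr tx; have /andP[c0 c1] := ratio_itv xr.
apply/cvg_vabsP; rewrite -cvg_shiftS /=.
apply: (@squeeze_cvgr _ _ _ _ (cst 0) (geometric (vabs x) (vabs x / r))).
- by apply: nearW => k; rewrite /= subr0 vabs_ge0 tx.
- exact: cvg_cst.
- by apply: cvg_geometric; rewrite ger0_norm.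
Qed.

(** On the disc of convergence the linear term [p * (u - 1)] of [u ^+ p - 1]
    dominates. With [t = u - 1], the inner binomial coefficients are divisible by
    [p], and [|t ^+ p| < |p * t|] means [|t| ^+ p.-1 < 1 / p], which for nonzero
    [t] is what [|t| < r] says. *)
Lemma vabs_exprp_sub1 (u : K) : vabs (u - 1) < r ->
  vabs (u ^+ p - 1) = p%:R^-1 * vabs (u - 1).
Proof.
set t := u - 1 => tr; have [t0|tn0] := eqVneq t 0.
  by rewrite t0 vabs0 // mulr0 -(subrK 1 u) -/t t0 add0r expr1n subrr vabs0.
have t_gt0 : 0 < vabs t by rewrite vabs_gt0.
have t1 : vabs t < 1 := lt_trans tr exp_radius_lt1.
have p0 : 0 < p%:R^-1 :> R by rewrite invr_gt0 ltr0n prime_gt0.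
have -> : u ^+ p - 1 = p%:R * t + \sum_(2 <= i < p.+1) t ^+ i *+ 'C(p, i).
  have -> : u = 1 + t by rewrite addrC subrK.
  rewrite exprDn -(big_mkord xpredT
    (fun i => 1 ^+ (p - i) * t ^+ i *+ 'C(p, i))) /=.
  rewrite big_ltn // big_ltn ?ltnS ?prime_gt0 //.
  rewrite bin0 bin1 expr0 expr1n expr1 mul1r mulr1n addrAC addrA subrr add0r.
  rewrite expr1n mul1r mulr_natl; congr (_ + _).
  by apply: eq_bigr => i _; rewrite expr1n mul1r.
rewrite -(@vabs_p p R K) -vabsM; apply: vabsD_dominant; rewrite vabsM vabs_p.
rewrite big_nat; apply: vabs_sum_lt => [//||i /andP[i2 ip]].
  exact: mulr_gt0.
rewrite -mulr_natl vabsM vabsX //; move: ip; rewrite ltnS leq_eqVlt.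
case/orP => [/eqP ->|ip].
  rewrite binn vabs1 // mul1r.
  have -> : vabs t ^+ p = vabs t ^+ p.-1 * vabs t.
    by rewrite -exprSr prednK ?prime_gt0.
  rewrite ltr_pM2r // -exp_radiusX ltrXn2r ?vabs_ge0 //.
  by have := prime_gt1 p_prime; lia.
have /dvdnP[m ->] : (p %| 'C(p, i))%N by rewrite prime_dvd_bin // (ltnW i2).
rewrite natrM vabsM vabs_p; apply: le_lt_trans (_ : p%:R^-1 * vabs t ^+ i < _).
  by rewrite -mulrA ler_piMl ?vabs_nat_le1 ?mulr_ge0 ?exprn_ge0 ?vabs_ge0 ?ltW.
by rewrite ltr_pM2l // -[ltRHS]expr1 ltr_iXn2l.
Qed.

Lemma vabs_exprpn_sub1 (u : K) N : vabs (u - 1) < r ->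
  vabs (u ^+ (p ^ N) - 1) = p%:R^-1 ^+ N * vabs (u - 1).
Proof.
move=> ur; elim: N => [|N IHN]; first by rewrite expr0 expn0 expr1 mul1r.
rewrite expnSr exprM vabs_exprp_sub1 ?IHN ?exprS ?mulrA //.
apply: le_lt_trans ur; rewrite ler_piMl ?vabs_ge0 // exprn_ile1 //.
by rewrite invf_le1 ?ltr0n ?ler1n ?prime_gt0.
Qed.

End ExpRadius.

(** * Exponential and logarithm *)

(** Both sides sum [f j * g i] over the triangle [i + j < n]. *)
Lemma sum_cauchy_product (V : pzRingType) (f g : nat -> V) n :
  \sum_(0 <= k < n) \sum_(0 <= i < k.+1) f (k - i)%N * g i =
  \sum_(0 <= i < n) (\sum_(0 <= j < n - i) f j) * g i.
Proof.
elim: n => [|n IHn]; first by rewrite !big_geq.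
rewrite big_nat_recr //= IHn [RHS](eq_big_nat _ _ (F2 := fun i =>
  (\sum_(0 <= j < n - i) f j) * g i + f (n - i)%N * g i)); last first.
  by move=> i /andP[_ i_n]; rewrite subSn // big_nat_recr //= mulrDl.
rewrite big_split /=; congr (_ + _).
by rewrite big_nat_recr //= subnn [X in X * g n]big_geq // mul0r addr0.
Qed.

Section ExpLog.
Context {p : nat} (p_prime : prime p) {R : realType}.
Context {K : complexPadicType p R}.
Local Notation r := (exp_radius p R).
Local Open Scope classical_set_scope.

(** The product of two partial sums of length [n] differs from the partial sum
    of the Cauchy product by terms [f j * g i] with [n <= i + j], all bounded by
    [c ^ n]; by the ultrametric inequality so is their sum. *)
Lemma cauchy_product_cvg (f g : nat -> K) (a b : K) (c : R) : 0 <= c < 1 ->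
  (forall k, vabs (f k) <= c ^+ k) -> (forall k, vabs (g k) <= c ^+ k) ->
  series f @ \oo --> a -> series g @ \oo --> b ->
  series (fun k => \sum_(0 <= i < k.+1) f (k - i)%N * g i) @ \oo --> a * b.
Proof.
move=> /andP[c0 c1] fc gc fa gb.
(* [D n] is the sum over the part of the square outside of the triangle. *)
pose D n := \sum_(0 <= i < n) (\sum_(n - i <= j < n) f j) * g i.
have -> : series (fun k => \sum_(0 <= i < k.+1) f (k - i)%N * g i) =
    (fun n => series f n * series g n + - 1 * D n).
  apply: funext => n; rewrite mulN1r /series /= sum_cauchy_product.
  apply/eqP; rewrite -subr_eq opprK -big_split mulr_sumr; apply/eqP.
  apply: eq_bigr => i _ /=.
  by rewrite -mulrDl [in RHS](big_cat_nat (leq0n (n - i)) (leq_subr i n)).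
rewrite -[a * b]addr0; apply: padic_cvgD; first exact: padic_cvgM.
rewrite -(mulr0 (- 1)); apply: padic_cvgMl.
apply: (@vabs_cvg_squeeze _ _ _ _ _ (fun n => c ^+ n)); last first.
  by apply: cvg_expr; rewrite ger0_norm.
move=> n; rewrite subr0 /D big_nat; apply: vabs_sum_le => // [|i /andP[_ i_n]].
  exact: exprn_ge0.
rewrite vabsM -[X in c ^+ X](subnK (ltnW i_n)) exprD.
apply: ler_pM; rewrite ?vabs_ge0 // big_nat.
apply: vabs_sum_le => // [|j /andP[ij _]]; first exact: exprn_ge0.
by apply: le_trans (fc j) _; rewrite ler_wiXn2l // ltW.
Qed.

Lemma exp_term_cvg (x : K) : vabs x < r ->
  (fun k => x ^+ k / k`!%:R) @ \oo --> (0 : K).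
Proof.
by move=> xr; apply: (radius_cvg _ xr) => // k; exact: vabs_exp_term.
Qed.

Lemma vabs_exp_term_le (x : K) k : vabs x < r -> (0 < k)%N ->
  vabs (x ^+ k / k`!%:R) <= vabs x.
Proof.
move=> xr k_gt0; have /andP[c0 c1] := ratio_itv p_prime xr.
apply: le_trans (vabs_exp_term p_prime x k_gt0) _.
by rewrite ler_piMr ?vabs_ge0 // exprn_ile1 // ltW.
Qed.

Lemma vabs_padic_exp_sub1 (x : K) :
  vabs x < r -> vabs (padic_exp x - 1) <= vabs x.
Proof.
move=> xr.
have -> : 1 = series (fun k => x ^+ k / k`!%:R) 1.
  by rewrite /series /= big_nat1 expr0 fact0 divr1.
apply: vabs_series_tail_le => //; [exact: exp_term_cvg|exact: vabs_ge0|].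
by move=> k; exact: vabs_exp_term_le.
Qed.

(** The terms of degree at least 2 contain the factor [a ^+ 2]. The bound is
    stated for [a * x] since what matters is that it is quadratic in [a]. *)
Lemma vabs_padic_exp_linear (a x : K) : vabs a <= 1 -> vabs x < r ->
  vabs (padic_exp (a * x) - (1 + a * x)) <= vabs a ^+ 2 * vabs x.
Proof.
move=> a1 xr; have axr : vabs (a * x) < r.
  by apply: le_lt_trans xr; rewrite vabsM ler_piMl ?vabs_ge0.
have -> : 1 + a * x = series (fun k => (a * x) ^+ k / k`!%:R) 2.
  by rewrite /series /= big_ltn // big_nat1 expr0 fact0 !divr1 expr1.
apply: vabs_series_tail_le => //; first exact: exp_term_cvg.
  by rewrite mulr_ge0 ?exprn_ge0 ?vabs_ge0.
move=> k k2; rewrite exprMn -mulrA vabsM vabsX //.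
apply: ler_pM; rewrite ?exprn_ge0 ?vabs_ge0 //; last first.
  by apply: vabs_exp_term_le => //; exact: leq_trans k2.
by rewrite ler_wiXn2l ?vabs_ge0.
Qed.

Lemma padic_exp0 : padic_exp (0 : K) = 1.
Proof.
apply/eqP; rewrite -subr_eq0 -(vabs_eq0P p_prime) eq_le vabs_ge0 andbT.
have := @vabs_padic_exp_sub1 0.
by rewrite vabs0 // exp_radius_gt0 //; apply.
Qed.

(** Both exponential series are dominated by the geometric series of ratio
    [Num.max |x| |y| / r], and the binomial formula identifies the Cauchy
    product of the two with the series at [x + y]. *)
Lemma padic_expD (x y : K) : vabs x < r -> vabs y < r ->
  padic_exp (x + y) = padic_exp x * padic_exp y.
Proof.
move=> xr yr; pose m := Num.max (vabs x) (vabs y).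
have mr : m < r by rewrite /m gt_max xr.
have m0 : 0 <= m by rewrite /m le_max vabs_ge0.
have c_itv : 0 <= m / r < 1.
  have r0 := @exp_radius_gt0 _ p_prime R.
  by rewrite divr_ge0 ?(ltW r0) //= ltr_pdivrMr // mul1r.
have term (z : K) k : vabs z <= m -> vabs (z ^+ k / k`!%:R) <= (m / r) ^+ k.
  move=> zm; case: k => [|k]; first by rewrite !expr0 fact0 divr1 vabs1.
  apply: le_trans (vabs_exp_term p_prime z (ltn0Sn k)) _.
  have zmr : vabs z / r <= m / r by rewrite ler_pM2r ?invr_gt0 ?exp_radius_gt0.
  have z0 : 0 <= vabs z / r by rewrite divr_ge0 ?vabs_ge0 ?ltW ?exp_radius_gt0.
  rewrite exprS; apply: ler_pM; rewrite ?vabs_ge0 ?exprn_ge0 //.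
  - apply: le_trans zm _; rewrite ler_peMr // invf_ge1 ?exp_radius_gt0 //.
    by rewrite ltW ?exp_radius_lt1.
  - by rewrite lerXn2r ?nnegrE //; case/andP: c_itv.
have limexp (z : K) : vabs z < r ->
    series (fun k => z ^+ k / k`!%:R) @ \oo --> padic_exp z.
  by move=> zr; apply: series_limK => //; exact: exp_term_cvg.
rewrite {1}/padic_exp; apply: limKE => //.
have -> : (fun k => (x + y) ^+ k / k`!%:R) = (fun k =>
    \sum_(0 <= i < k.+1) (x ^+ (k - i) / (k - i)`!%:R) * (y ^+ i / i`!%:R)).
  apply: funext => k; rewrite exprDn mulr_suml big_mkord; apply: eq_bigr => i _.
  have ik : (i <= k)%N by rewrite -ltnS.
  have nz n : n`!%:R != 0 :> K by rewrite natf_eq0_padic // -lt0n fact_gt0.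
  rewrite -(bin_fact ik) !natrM -mulr_natr; field.
  by rewrite !nz natf_eq0_padic // -lt0n bin_gt0 ik.
apply: (@cauchy_product_cvg (fun k => x ^+ k / k`!%:R)
  (fun k => y ^+ k / k`!%:R) _ _ _ c_itv).
- by move=> k; apply: term; rewrite /m le_max lexx.
- by move=> k; apply: term; rewrite /m le_max lexx orbT.
- exact: limexp.
- exact: limexp.
Qed.

Lemma vabs_natM_lt (x : K) n : vabs x < r -> vabs (n%:R * x) < r.
Proof.
by apply: le_lt_trans; rewrite vabsM ler_piMl ?vabs_ge0 ?vabs_nat_le1.
Qed.

Lemma padic_expMn (x : K) n :
  vabs x < r -> padic_exp (n%:R * x) = padic_exp x ^+ n.
Proof.
move=> xr; elim: n => [|n IHn]; first by rewrite mul0r padic_exp0.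
by rewrite -natr1 mulrDl mul1r padic_expD ?vabs_natM_lt // IHn exprSr.
Qed.

Lemma padic_expN (x : K) : vabs x < r -> padic_exp (- x) = (padic_exp x)^-1.
Proof.
move=> xr; have e1 : padic_exp x * padic_exp (- x) = 1.
  by rewrite -padic_expD ?vabsN // subrr padic_exp0.
have e0 : padic_exp x != 0.
  by apply: contra_eq_neq e1 => ->; rewrite mul0r eq_sym oner_eq0.
by apply: (mulfI e0); rewrite e1 divff.
Qed.

Lemma natr_bin_diag M k :
  'C(M, k.+1)%:R = M%:R * 'C(M.-1, k)%:R * k.+1%:R^-1 :> K.
Proof.
by rewrite -natrM mul_bin_diag natrM mulrAC mulfV ?mul1r // natf_eq0_padic.
Qed.

(** Pascal's rule gives ['C(M.-1, k.+1) = 'C(M, k.+1) - 'C(M.-1, k)], where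
    ['C(M, k.+1) = M / k.+1 * 'C(M.-1, k)] is small when [M] is. *)
Lemma vabs_binpred_sub_sign (M k : nat) : (0 < M)%N ->
  vabs ('C(M.-1, k)%:R - (-1) ^+ k : K) <= vabs (M%:R : K) * k.+1%:R.
Proof.
move=> M_gt0; have M0 : 0 <= vabs (M%:R : K) by exact: vabs_ge0.
elim: k => [|k IHk].
  by rewrite bin0 expr0 subrr vabs0 // mulr1.
have -> : 'C(M.-1, k.+1)%:R - (-1) ^+ k.+1 =
    'C(M, k.+1)%:R - ('C(M.-1, k)%:R - (-1) ^+ k) :> K.
  by rewrite -{2}(prednK M_gt0) binS natrD exprS; ring.
have kk : vabs (M%:R : K) * k.+1%:R <= vabs (M%:R : K) * k.+2%:R.
  by rewrite ler_wpM2l // ler_nat.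
apply: vabsB_le => //; last exact: le_trans IHk kk.
apply: le_trans kk.
rewrite natr_bin_diag 2!vabsM -mulrA ler_wpM2l //.
apply: le_trans (@vabs_natV_le _ p_prime _ K _ (ltn0Sn k)).
by rewrite ler_piMl ?vabs_ge0 ?vabs_nat_le1.
Qed.

Section LogOf.
Context {q : K} (q_near1 : vabs (q - 1) < r).
Let t k := (-1) ^+ k * (q - 1) ^+ k.+1 / k.+1%:R.

Let vabs_t k : vabs (t k) = vabs ((q - 1) ^+ k.+1 / k.+1%:R).
Proof.
by rewrite /t -mulrA vabsM vabsX // vabsN vabs1 // expr1n mul1r.
Qed.

Let t_cvg : t @ \oo --> (0 : K).
Proof.
have /andP[c0 c1] := ratio_itv p_prime q_near1.
apply: (@vabs_cvg_squeeze _ _ _ _ _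
  (geometric (vabs (q - 1)) (vabs (q - 1) / r))).
  by move=> k; rewrite subr0 vabs_t vabs_log_term.
by apply: cvg_geometric; rewrite ger0_norm.
Qed.

Lemma vabs_padic_log_le : vabs (padic_log q) <= vabs (q - 1).
Proof.
rewrite -[padic_log q]subr0 -[X in _ - X](_ : series t 0 = 0); last first.
  by rewrite /series /= big_geq.
apply: vabs_series_tail_le => //; first exact: vabs_ge0.
move=> k _; rewrite vabs_t; have /andP[c0 c1] := ratio_itv p_prime q_near1.
apply: le_trans (vabs_log_term p_prime _ _) _.
by rewrite ler_piMr ?vabs_ge0 // exprn_ile1 // ltW.
Qed.

(** The binomial expansion of [(q ^+ M - 1) / M] has the coefficients
    ['C(M.-1, k) / k.+1], and ['C(M.-1, k)] is close to [(-1) ^+ k] when [M] is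
    divisible by a high power of [p]: the logarithm is the limit of these
    quotients.  The distance of the coefficients has a factor [k.+1], which the
    geometric decay of the terms of the logarithm absorbs
    ([geometric_slope_bound]); this makes the error quadratic in [M], uniformly
    in [k]. *)
Lemma vabs_exprn_log (M : nat) : (0 < M)%N ->
  vabs (q ^+ M - (1 + M%:R * padic_log q)) <=
    vabs (M%:R : K) ^+ 2 * (vabs (q - 1) / (1 - vabs (q - 1) / r)).
Proof.
move=> M_gt0; set x := q - 1; have /andP[c0 c1] := ratio_itv p_prime q_near1.
rewrite -/x in c0 c1; have M0 : M%:R != 0 :> K.
  by rewrite natf_eq0_padic // -lt0n.
(* The series of [b] is stationary from [M] on, with sum [(q ^+ M - 1) / M]. *)
pose b k := 'C(M.-1, k)%:R * x ^+ k.+1 / k.+1%:R.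
have qM n : (M <= n)%N -> q ^+ M = 1 + M%:R * series b n.
  move=> Mn; have -> : q = 1 + x by rewrite addrC subrK.
  rewrite exprDn -(big_mkord xpredT
    (fun i => 1 ^+ (M - i) * x ^+ i *+ 'C(M, i))).
  rewrite big_ltn // bin0 expr1n expr0 mulr1 mulr1n big_add1 /=; congr (_ + _).
  rewrite /series /= (big_cat_nat (leq0n M) Mn) /= mulrDr.
  rewrite [X in _ = _ + _ * X]big_nat [X in _ = _ + _ * X]big1; last first.
    by move=> k /andP[Mk _]; rewrite /b bin_small ?mul0r //; lia.
  rewrite mulr0 addr0 mulr_sumr; apply: eq_bigr => k _.
  by rewrite expr1n mul1r -mulr_natl /b natr_bin_diag; ring.
have := @padic_cvgMl _ _ _ _ _ M%:R (series_limK p_prime t_cvg).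
rewrite -/(padic_log q) => Mlog.
have lim1 : (fun n => (q ^+ M - 1) + - (M%:R * series t n)) @ \oo -->
    (q ^+ M - 1) - M%:R * padic_log q.
  apply: padic_cvgD; first exact: cvg_cst.
  rewrite -mulN1r; under eq_fun do rewrite -mulN1r; exact: padic_cvgMl.
rewrite opprD addrA; apply: (vabs_lim_le lim1).
exists M => // n /= Mn.
rewrite (qM _ Mn) [1 + _]addrC addrK -mulrBr vabsM expr2.
rewrite -mulrA ler_wpM2l ?vabs_ge0 // /series /= -sumrB.
apply: vabs_sum_le => // [|k _].
  by rewrite mulr_ge0 ?vabs_ge0 // divr_ge0 ?vabs_ge0 // subr_ge0 ltW.
have -> : b k - t k = ('C(M.-1, k)%:R - (-1) ^+ k) * (x ^+ k.+1 / k.+1%:R).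
  by rewrite /b /t -/x; ring.
rewrite vabsM; apply: le_trans (ler_pM (vabs_ge0 _) (vabs_ge0 _)
  (vabs_binpred_sub_sign k M_gt0) (vabs_log_term p_prime x k)) _.
rewrite -mulrA ler_wpM2l ?vabs_ge0 // mulrCA ler_wpM2l ?vabs_ge0 //.
rewrite -[leRHS]div1r ler_pdivlMr ?subr_gt0 //.
apply: le_trans (geometric_slope_bound k _) _; first by rewrite c0 ltW.
by rewrite lerBlDr lerDl exprn_ge0.
Qed.

End LogOf.

Lemma vabs_padic_log_lt (q : K) : vabs (q - 1) < r -> vabs (padic_log q) < r.
Proof. by move=> qr; apply: le_lt_trans (vabs_padic_log_le qr) qr. Qed.

Lemma cvg_exprp_invn (c : R) : (fun N => p%:R^-1 ^+ N * c) @ \oo --> (0 : R).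
Proof.
rewrite -(mul0r c); apply: cvgM; last exact: cvg_cst.
apply: cvg_expr; rewrite ger0_norm ?invr_ge0 ?ler0n //.
by rewrite invf_lt1 ?ltr0n ?ltr1n ?prime_gt0 ?prime_gt1.
Qed.

(** The quotient [u] of [exp (log q)] by [q] satisfies
    [|M| * |u - 1| = |u ^+ M - 1| <= |M| ^+ 2 * C] for every power [M] of [p],
    with [C] independent of [M]. *)
Lemma padic_exp_log (q : K) : vabs (q - 1) < r -> padic_exp (padic_log q) = q.
Proof.
move=> qr; set L := padic_log q; set Q := padic_exp L.
have Lr : vabs L < r := vabs_padic_log_lt qr.
have q1 : vabs q = 1.
  by apply: (vabs_near1 p_prime); apply: lt_trans qr _; exact: exp_radius_lt1.
have q0 : q != 0 by rewrite -vabs_eq0P // q1 oner_eq0.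
pose u := Q / q; suff : u = 1 by move=> u1; rewrite -(divfK q0 Q) -/u u1 mul1r.
have ur : vabs (u - 1) < r.
  have -> : u - 1 = (Q - q) / q by rewrite /u mulrBl divff.
  rewrite vabsM vabsV // q1 invr1 mulr1 -(subrKA 1).
  apply: vabsD_lt; last by rewrite vabsBC.
  exact: le_lt_trans (vabs_padic_exp_sub1 Lr) Lr.
have /andP[c0 c1] := ratio_itv p_prime qr.
set C := vabs (q - 1) / (1 - vabs (q - 1) / r).
have LC : vabs L <= C.
  apply: le_trans (vabs_padic_log_le qr) _.
  by rewrite ler_peMr ?vabs_ge0 // invf_ge1 ?subr_gt0 // lerBlDr lerDl.
have u_close N : vabs (u - 1) <= p%:R^-1 ^+ N * C.
  have M_gt0 : (0 < p ^ N)%N by rewrite expn_gt0 prime_gt0.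
  have vM : vabs ((p ^ N)%:R : K) = p%:R^-1 ^+ N.
    by rewrite natrX vabsX // vabs_p.
  have pN0 : 0 < p%:R^-1 ^+ N :> R.
    by rewrite exprn_gt0 // invr_gt0 ltr0n prime_gt0.
  rewrite -(ler_pM2l pN0) -vabs_exprpn_sub1 //.
  have -> : u ^+ (p ^ N) - 1 = (Q ^+ (p ^ N) - q ^+ (p ^ N)) / q ^+ (p ^ N).
    by rewrite mulrBl divff ?expf_neq0 // expr_div_n.
  rewrite vabsM vabsV // [vabs (q ^+ _)]vabsX // q1 expr1n invr1 mulr1.
  rewrite -(subrKA (1 + (p ^ N)%:R * L)) mulrA -expr2 -vM; apply: vabsD_le.
    rewrite -padic_expMn //.
    apply: le_trans (vabs_padic_exp_linear (vabs_nat_le1 p_prime _) Lr) _.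
    by rewrite ler_wpM2l ?exprn_ge0 ?vabs_ge0.
  by rewrite vabsBC; exact: vabs_exprn_log.
apply: (@padic_cvg_unique _ p_prime _ _ (cst u)); first exact: cvg_cst.
exact: (vabs_cvg_squeeze u_close (cvg_exprp_invn C)).
Qed.

Lemma qpow_nat (q : K) n : vabs (q - 1) < r -> qpow q n%:R = q ^+ n.
Proof.
by move=> qr; rewrite /qpow padic_expMn ?vabs_padic_log_lt // padic_exp_log.
Qed.

Lemma qpow_natN (q : K) n : vabs (q - 1) < r -> qpow q (- n%:R) = q ^- n.
Proof.
move=> qr; rewrite /qpow mulNr padic_expN ?vabs_natM_lt ?vabs_padic_log_lt //.
by rewrite padic_expMn ?vabs_padic_log_lt // padic_exp_log.
Qed.

End ExpLog.

(** * Alternating moments and Euler numbers *)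

Lemma alternating_sum_shift (V : pzRingType) (f : nat -> V) m :
  \sum_(0 <= x < m) (-1) ^+ x * (f x.+1 + f x) = f 0%N - (-1) ^+ m * f m.
Proof.
elim: m => [|m IHm]; first by rewrite big_geq // expr0 mul1r subrr.
rewrite big_nat_recr //= IHm mulrDr addrACA addNr addr0.
by rewrite exprS mulN1r mulNr opprK.
Qed.

Section EulerMoments.
Context {p : nat} (p_prime : prime p) (p_odd : odd p) {R : realType}.
Context {K : complexPadicType p R}.
Context (q : K) (q_near1 : vabs (q - 1) < exp_radius p R) (q_neq1 : q != 1).
Local Open Scope classical_set_scope.

Definition qnum (x : nat) : K := (1 - q ^+ x) / (1 - q).

Definition alternating_moment n N : K :=
  \sum_(0 <= x < p ^ N) (-1) ^+ x * qnum x ^+ n.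

Let q1_lt1 : vabs (q - 1) < 1.
Proof. exact: lt_trans q_near1 (exp_radius_lt1 p_prime). Qed.

Let vabs_q : vabs q = 1. Proof. exact: (vabs_near1 p_prime q1_lt1). Qed.

Let onem_q_neq0 : 1 - q != 0.
Proof. by rewrite subr_eq0 eq_sym. Qed.

Lemma qnumS x : qnum x.+1 = q * qnum x + 1.
Proof. by rewrite /qnum exprS; field. Qed.

(** [1 + q ^+ n] is close to 2, a unit because [p] is odd. *)
Lemma vabs_add1_expr n : vabs (1 + q ^+ n) = 1.
Proof.
have v2 : vabs (2%:R : K) = 1.
  by apply: vabs_nat_coprime => //; rewrite coprime_sym coprime2n.
rewrite (_ : 1 + q ^+ n = 2%:R + (q ^+ n - 1)); last by ring.
rewrite vabsD_dominant v2 // subrX1 vabsM.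
apply: le_lt_trans q1_lt1; rewrite ler_piMr ?vabs_ge0 //.
by apply: vabs_sum_le => // i _; rewrite vabsX // vabs_q expr1n.
Qed.

Lemma add1_expr_neq0 n : 1 + q ^+ n != 0.
Proof. by rewrite -(vabs_eq0P p_prime) vabs_add1_expr oner_eq0. Qed.

Lemma expr_pn_cvg : (fun N => q ^+ (p ^ N)) @ \oo --> 1.
Proof.
apply: (vabs_cvg_squeeze _ (cvg_exprp_invn p_prime (vabs (q - 1)))) => N.
by rewrite vabs_exprpn_sub1.
Qed.

Lemma qnum_pn_cvg n : (fun N => qnum (p ^ N) ^+ n) @ \oo --> (0 ^+ n : K).
Proof.
elim: n => [|n IHn]; first by under eq_fun do rewrite expr0; exact: cvg_cst.
under eq_fun do rewrite exprS; rewrite exprS; apply: padic_cvgM => //.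
have -> : (fun N => qnum (p ^ N)) =
    (fun N => (1 - q)^-1 + - (1 - q)^-1 * q ^+ (p ^ N)).
  by apply: funext => N; rewrite /qnum; field.
rewrite -[X in _ --> X](subrr (1 - q)^-1) -[X in _ --> _ - X]mulr1 -mulNr.
by apply: padic_cvgD; [exact: cvg_cst | apply: padic_cvgMl; exact: expr_pn_cvg].
Qed.

(** The theorem before passing to the limit: by [qnumS] and the binomial formula
    the left-hand side is the sum of the
    [(-1) ^+ x * (qnum x.+1 ^+ n + qnum x ^+ n)], which telescopes. *)
Lemma alternating_moment_rec n N :
  \sum_(0 <= l < n.+1) 'C(n, l)%:R * q ^+ l * alternating_moment l N
    + alternating_moment n N = 0 ^+ n + qnum (p ^ N) ^+ n.
Proof.
have -> : \sum_(0 <= l < n.+1) 'C(n, l)%:R * q ^+ l * alternating_moment l N =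
    \sum_(0 <= x < p ^ N) (-1) ^+ x * qnum x.+1 ^+ n.
  under eq_bigr do rewrite mulr_sumr.
  rewrite exchange_big /=; apply: eq_bigr => x _.
  rewrite qnumS addrC exprDn mulr_sumr big_mkord; apply: eq_bigr => l _.
  by rewrite expr1n mul1r (exprMn _ q) mulrCA -mulrA mulr_natl.
rewrite /alternating_moment -big_split /=; under eq_bigr do rewrite -mulrDr.
rewrite (alternating_sum_shift (fun x => qnum x ^+ n)).
rewrite -signr_odd oddX p_odd orbT expr1 mulN1r opprK.
by rewrite /qnum expr0 subrr mul0r.
Qed.

(** Solving [alternating_moment_rec] for the moment of order [n] expresses it by
    those of smaller order; its coefficient [1 + q ^+ n] does not vanish. *)
Lemma alternating_moment_cvg n : exists l : K, alternating_moment n @ \oo --> l.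
Proof.
have [m] := ubnP n; elim: m n => // m IHm n /ltnSE nm.
have {}IHm (l : 'I_n) : exists z : K, alternating_moment l @ \oo --> z.
  by apply: IHm; exact: leq_trans nm.
have [s s_lim] := choice IHm.
eexists; rewrite (_ : alternating_moment n = fun N => (1 + q ^+ n)^-1 *
  ((0 ^+ n + qnum (p ^ N) ^+ n) + - 1 *
    \sum_(l < n) 'C(n, l)%:R * q ^+ l * alternating_moment l N)).
  apply: padic_cvgMl; apply: padic_cvgD.
    by apply: padic_cvgD; [exact: cvg_cst | exact: qnum_pn_cvg].
  by apply: padic_cvgMl; apply: padic_cvg_sum => l;
    apply: padic_cvgMl (s_lim l).
apply: funext => N; rewrite -alternating_moment_rec big_nat_recr //= binn mul1r.
by rewrite big_mkord; field; exact: add1_expr_neq0.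
Qed.

Lemma mqbracket_inv_cvg :
  (fun N => (mqbracket q (p ^ N))^-1) @ \oo --> (1 + q) / 2%:R.
Proof.
have two0 : 2%:R != 0 :> K by have := add1_expr_neq0 0; rewrite expr0.
have -> : (fun N => (mqbracket q (p ^ N))^-1) =
    (fun N => (1 + q) * (1 + q ^+ (p ^ N))^-1).
  apply: funext => N; rewrite /mqbracket exprNn -signr_odd oddX p_odd orbT.
  by rewrite expr1 mulN1r opprK invf_div.
apply: padic_cvgMl.
apply: (vabs_cvg_squeeze _ (cvg_exprp_invn p_prime (vabs (q - 1)))) => N.
rewrite -vabs_exprpn_sub1 // vabsBC.
have -> : 2%:R^-1 - (1 + q ^+ (p ^ N))^-1 =
    (q ^+ (p ^ N) - 1) / (2%:R * (1 + q ^+ (p ^ N))).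
  by field; rewrite two0 add1_expr_neq0.
have v2 : vabs (2%:R : K) = 1 by have := vabs_add1_expr 0; rewrite expr0.
by rewrite vabsM vabsV // vabsM v2 vabs_add1_expr mulr1 invr1 mulr1.
Qed.

(** The factor [q ^- x] of the integrand turns the weight [(- q) ^+ x] into
    [(-1) ^+ x]. *)
Lemma qEulerE n :
  qEuler n q = (1 + q) / 2%:R * limK (alternating_moment n).
Proof.
have [l nl] := alternating_moment_cvg n; rewrite (limKE p_prime nl).
apply: (limKE p_prime).
rewrite (_ : (fun N : nat => _) =
  (fun N => (mqbracket q (p ^ N))^-1 * alternating_moment n N)).
  by apply: padic_cvgM => //; exact: mqbracket_inv_cvg.
apply: funext => N; congr (_ * _); apply: eq_bigr => x _ /=.
have q0 : q != 0 by rewrite -(vabs_eq0P p_prime) vabs_q oner_eq0.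
rewrite /qbracket qpow_natN // qpow_nat // -/(qnum x) (exprNn q).
by rewrite [q ^- x * _]mulrC mulrCA mulfVK // expf_neq0.
Qed.

Lemma limK_alternating_moment_rec n :
  \sum_(0 <= l < n.+1) 'C(n, l)%:R * q ^+ l * limK (alternating_moment l)
    + limK (alternating_moment n) = 0 ^+ n + 0 ^+ n.
Proof.
have mom_lim l : alternating_moment l @ \oo --> limK (alternating_moment l).
  by have [z lz] := alternating_moment_cvg l; rewrite (limKE p_prime lz).
apply: (@padic_cvg_unique _ p_prime _ _ (fun N => 0 ^+ n + qnum (p ^ N) ^+ n)).
  under eq_fun do rewrite -alternating_moment_rec.
  apply: padic_cvgD => //; apply: padic_cvg_sum => l; exact: padic_cvgMl.
by apply: padic_cvgD; [exact: cvg_cst | exact: qnum_pn_cvg].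
Qed.

End EulerMoments.

Theorem theorem6 (p : nat) (p_prime : prime p) (p_odd : odd p)
    (R : realType) (K : complexPadicType p R) (q : K)
    (q_near1 : vabs (q - 1) < p%:R `^ (- (p.-1%:R)^-1)) (q_neq1 : q != 1)
    (n : nat) :
  \sum_(0 <= l < n.+1) 'C(n, l)%:R * q ^+ l * qEuler l q + qEuler n q =
    if n == 0%N then qbracket q 2%:R else 0.
Proof.
under eq_bigr do rewrite qEulerE // mulrCA.
rewrite qEulerE // -mulr_sumr -mulrDr limK_alternating_moment_rec //.
case: n => [|n] /=; last by rewrite exprS mul0r addr0 mulr0.
have two0 : 2%:R != 0 :> K by rewrite natf_eq0_padic.
have q1 : 1 - q != 0 by rewrite subr_eq0 eq_sym.
by rewrite /qbracket qpow_nat // expr0; field; rewrite two0 q1.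
Qed.
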